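(* For every integer $r\geqslant 2$ there are infinitely many primitive covering numbers having exactly $r$ distinct prime divisors.
   Context: For $a\in\mathbb{Z}$ and a positive integer $n$, $a(\mathrm{mod}\ n)=\{a+nx: x\in\mathbb{Z}\}$ is the residue class with modulus $n$. A finite system of residue classes $\{a_i(\mathrm{mod}\ n_i)\}_{i=1}^k$ is a cover of $\mathbb{Z}$ if every integer lies in at least one of the classes $a_i(\mathrm{mod}\ n_i)$. A positive integer $n$ is called a covering number if there is a cover of $\mathbb{Z}$ whose moduli are all distinct, greater than one, and divisors of $n$. A covering number is called a primitive covering number if none of its proper divisors (positive divisors smaller than the number itself) is a covering number. *)

(* Defs.v *)
From HB Require Import structures.
From mathcomp Require Import all_boot all_order all_algebra.
From mathcomp Require Import boolp classical_sets cardinality.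

Set Implicit Arguments.
Unset Strict Implicit.
Unset Printing Implicit Defensive.

Import GRing.Theory Num.Theory.

Local Open Scope classical_set_scope.
Local Open Scope ring_scope.

Definition residue_class (a : int) (n : nat) : set int :=
  [set a + n%:Z * x | x in [set: int]].

(* A finite system of residue classes is a list of pairs
   (representative, modulus). *)
Definition is_cover (S : seq (int * nat)) : Prop :=
  forall z : int, exists2 c, c \in S & residue_class c.1 c.2 z.

Definition covering_number (n : nat) : Prop :=
  (0 < n)%N /\
  exists S : seq (int * nat),
    [/\ is_cover S,
        uniq [seq c.2 | c <- S],
        forall c, c \in S -> (1 < c.2)%N
      & forall c, c \in S -> (c.2 %| n)%N].

Definition primitive_covering_number (n : nat) : Prop :=
  covering_number n /\
  forall d : nat, (0 < d)%N -> (d < n)%N -> (d %| n)%N -> ~ covering_number d.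

(* Main.v *)
(* Write d(n) for the number of divisors of n. Passing from n to n * q, with q
   prime, brings d(n * q) - d(n) new moduli; inside a class modulo n left
   uncovered, each new modulus disposes of one of the q subclasses modulo n * q,
   and of no more than one. Hence, if A is not covering but can be made to miss
   a single class, and if q does not divide A and d(A) = q - 1, then the same
   holds for every A * q^b.
   Starting from A = 1, q = 2, such pairs (A, q) with arbitrarily many primes
   are built by choosing a prime q' = 1 mod 2 (q - 1) and replacing A by A * q^a
   with d(A * q^a) = (q - 1)(a + 1) = q' - 1. For a large prime p and
   b = floor((p - 1) / (q - 1)), one has d(A * q^b) >= p, so A * q^b * p is
   covering, while every proper divisor m of A * q^b has d(m) < p, which makes
   A * q^b * p primitive. *)

Require Import Defs.
From mathcomp Require Import all_boot all_order all_algebra all_field.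
From mathcomp Require Import boolp classical_sets cardinality.
From mathcomp Require Import ring zify.

Import GRing.Theory Num.Theory.

(** * Primes congruent to 1 modulo [m] *)

(** If all these values lay in {-1, 0, 1}, the nonzero polynomial P (P - 1) (P + 1) would vanish at
    every multiple of [m]; [size Q] of them are already too many roots. *)
Lemma nonconstant_poly_norm_gt1 (P : {poly int}) (m : nat) :
  0 < m -> 1 < size P -> exists j, 1 < `|P.[Posz (m * j)]%R|.
Proof.
move=> m0 szP; apply: contrapT => /forallNP small.
have shift_neq0 (c : int) : (P - c%:P != 0)%R.
  apply: contraTneq szP => /subr0_eq ->.
  by rewrite -leqNgt size_polyC leq_b1.
pose Q := ((P - 0%:P) * ((P - 1%:P) * (P - (- 1)%:P)))%R.
have Q0 : Q != 0%R by rewrite !mulf_neq0 ?shift_neq0.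
pose rs := [seq Posz (m * j) | j <- iota 0 (size Q)].
have rsQ : all (root Q) rs.
  apply/allP => _ /mapP[j _ ->].
  have /negP := small j; rewrite -leqNgt => Pj.
  rewrite /Q !rootM !rootE !hornerE.
  by move: (P.[_]%R) Pj => y; case: (intP y) => [|n|n] //=; lia.
have uniq_rs : uniq rs.
  rewrite map_inj_in_uniq ?iota_uniq // => i j _ _ [] /eqP.
  by rewrite eqn_pmul2l // => /eqP.
by have := max_poly_roots Q0 rsQ uniq_rs; rewrite size_map size_iota ltnn.
Qed.

(* A prime dividing a large value of the m-th cyclotomic polynomial at a
   multiple of m: modulo that prime, X^m - 1 is separable, so a root of Phi_m
   is no root of another Phi_d and has order exactly m. *)
Lemma prime_1_mod (m : nat) : 0 < m -> exists2 p, prime p & m %| p.-1.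
Proof.
move=> m0.
have szPhi : 1 < size 'Phi_m by rewrite size_Cyclotomic ltnS totient_gt0.
have [j gt1] := @nonconstant_poly_norm_gt1 _ m m0 szPhi.
have [p p_pr p_dvd] := pdivP gt1; exists p => //.
have charp := pchar_Fp p_pr.
pose x : 'F_p := (m * j)%:R%R.
pose F d : {poly 'F_p} := map_poly intr 'Phi_d.
have prodF n : 0 < n -> (\prod_(d <- divisors n) F d = 'X^n - 1)%R.
  move=> n0; rewrite -rmorph_prod prod_Cyclotomic //.
  by rewrite rmorphB /= map_polyXn rmorph1.
have Fmx : (F m).[x]%R = 0%R.
  rewrite /F /x -[((m * j)%:R)%R]/((m * j)%:~R)%R horner_map /=.
  by apply/eqP; rewrite -(dvdz_pcharf charp) dvdzE.
have m_div : m \in divisors m by rewrite divisors_id.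
have xm1 : (x ^+ m = 1)%R.
  apply/eqP; rewrite -subr_eq0; apply/eqP.
  have := congr1 (horner^~ x) (prodF m m0).
  by rewrite (big_rem m) //= hornerM Fmx mul0r !hornerE.
(* Evaluating at a multiple of [m] pays off here: if p divided [m], then [x] would be 0. *)
have m_neq0 : (m%:R != 0 :> 'F_p)%R.
  apply/eqP => m_eq0; move/eqP: xm1.
  by rewrite /x natrM m_eq0 mul0r expr0n eqn0Ngt m0 eq_sym oner_eq0.
have [k k_prim k_dvd] := prim_order_exists m0 xm1.
have x_neq0 : (x != 0)%R.
  by apply: contra_eq_neq xm1 => ->; rewrite expr0n eqn0Ngt m0 eq_sym oner_eq0.
suff km : k = m.
  rewrite -km (prim_order_dvd k_prim).
  apply/eqP/(mulfI x_neq0); rewrite -exprS prednK ?prime_gt0 // mulr1.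
  by rewrite -{2}(expf_card x) card_Fp.
have k0 := prim_order_gt0 k_prim.
apply/eqP/contraT => km.
have [d d_k Fdx] : exists2 d, d \in divisors k & (F d).[x]%R = 0%R.
  have := congr1 (horner^~ x) (prodF k k0).
  rewrite horner_prod !hornerE (prim_expr_order k_prim) subrr => /eqP.
  by rewrite prodf_seq_eq0 => /hasP[d d_k /eqP]; exists d.
have d_m : d \in rem m (divisors m).
  rewrite mem_rem_uniq ?divisors_uniq // inE -dvdn_divisors //.
  rewrite -dvdn_divisors // in d_k; rewrite (dvdn_trans d_k) // andbT.
  apply: contraNneq km => dm; rewrite eqn_dvd k_dvd.
  by rewrite -dm.
have [G] : exists G, ('X^m - 1 = F m * (F d * G))%R.
  exists (\prod_(e <- rem d (rem m (divisors m))) F e)%R.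
  by rewrite -prodF // (big_rem m) // (big_rem d).
(* The double root [x] kills the derivative, which is also m x^(m-1), a nonzero value. *)
move=> /(congr1 (fun P : {poly 'F_p} => (deriv P).[x]%R)) /eqP.
rewrite derivB derivXn -[1%R](polyC1) derivC subr0 !derivM.
rewrite !(hornerD, hornerM) Fmx Fdx !(mul0r, mulr0, addr0).
rewrite hornerMn hornerXn -mulr_natl.
by rewrite mulf_eq0 (negPf m_neq0) expf_eq0 (negPf x_neq0) andbF.
Qed.

(** * Covers as one class per divisor *)

Lemma residue_classP (a : int) (n : nat) (z : int) :
  residue_class a n z <-> (n %| (z - a)%R)%Z.
Proof.
split=> [[x _ <-]|/dvdzP[x zax]].
  by apply/dvdzP; exists x; ring.
by exists x => //; rewrite mulrC -zax; ring.
Qed.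

(** A function [f] on moduli builds in their distinctness; giving a class to every divisor is
    harmless, since extra classes never spoil a cover. *)
Definition hits (f : nat -> int) (n : nat) (z : int) :=
  exists2 d, (1 < d) && (d %| n) & (d %| (z - f d)%R)%Z.

Lemma covering_numberP (n : nat) :
  0 < n -> covering_number n <-> exists f, forall z, hits f n z.
Proof.
move=> n0; split=> [[_ [S [covS uniqS gt1 dvdS]]]|[f fP]].
  (* Distinct moduli make this lookup recover the right class; a modulus absent from [S] gets the
     default 0. *)
  pose f d := nth 0%R [seq c.1 | c <- S] (index d [seq c.2 | c <- S]).
  exists f => z; have [c cS /residue_classP zc] := covS z.
  exists c.2; first by rewrite gt1 // dvdS.
  have iS : index c S < size S by rewrite index_mem.
  have i2 : index c.2 [seq c.2 | c <- S] = index c S.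
    by rewrite -{1}(nth_index c cS) -(nth_map c 0 snd) // index_uniq ?size_map.
  by rewrite /f i2 (nth_map c) // nth_index.
split=> //; exists [seq (f d, d) | d <- divisors n & 1 < d]; split.
- move=> z; have [d /andP[d1 dn] dz] := fP z.
  exists (f d, d); last exact/residue_classP.
  by apply/map_f; rewrite mem_filter d1 -dvdn_divisors.
- by rewrite -map_comp map_id filter_uniq // divisors_uniq.
- by move=> c /mapP[d + ->]; rewrite mem_filter => /andP[].
- by move=> c /mapP[d + ->]; rewrite mem_filter -dvdn_divisors // => /andP[].
Qed.

(** * Passing from [n] to [n * q] *)

(** The class of [c] may be hit too, so covering numbers qualify; failure to cover is tracked
    separately. *)
Definition almost_covering (n : nat) : Prop :=
  exists f (c : int), forall z, (n %| (z - c)%R)%Z \/ hits f n z.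

Definition new_divisors (n q : nat) :=
  [seq d <- divisors (n * q) | ~~ (d %| n)].

Lemma size_new_divisors (n q : nat) : 0 < n -> 0 < q ->
  size (divisors (n * q)) = size (divisors n) + size (new_divisors n q).
Proof.
move=> n0 q0; rewrite -(count_predC (dvdn^~ n)) -!size_filter; congr (_ + _).
apply/perm_size/uniq_perm; rewrite ?filter_uniq ?divisors_uniq // => d.
rewrite mem_filter -!dvdn_divisors ?muln_gt0 ?n0 //.
by apply: andb_idr; apply: dvdn_mulr.
Qed.

Lemma mem_new_divisors (n q d : nat) : 0 < n -> 0 < q ->
  (d \in new_divisors n q) = ~~ (d %| n) && (d %| n * q).
Proof.
by move=> n0 q0; rewrite mem_filter -dvdn_divisors ?muln_gt0 ?n0.
Qed.

(** Old divisors keep their classes, and the new divisor of index [j] receives a class containing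
    that of [c + n * j] modulo [n * q]. *)
Lemma almost_covering_extend (n q : nat) :
  0 < n -> 0 < q -> almost_covering n ->
  exists f (c : int), forall z, hits f (n * q) z \/
    exists2 j, size (new_divisors n q) <= j < q &
      ((n * q)%N %| (z - (c + n%:Z * j%:Z))%R)%Z.
Proof.
move=> n0 q0 [f [c fP]]; set s := new_divisors n q.
pose g d := if d %| n then f d else (c + n%:Z * (index d s)%:Z)%R.
exists g, c => z; have [|[d /andP[d1 dn] dz]] := fP z; last first.
  by left; exists d; rewrite ?d1 ?dvdn_mulr // /g dn.
move=> /dvdzP[t zct]; pose j := `|(t %% q)%Z|%N.
have jE : Posz j = (t %% q)%Z by rewrite gez0_abs // modz_ge0 // -lt0n.
have jq : (j < q)%N by rewrite -ltz_nat jE ltz_pmod.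
have zj : ((n * q)%N %| (z - (c + n%:Z * j%:Z))%R)%Z.
  apply/dvdzP; exists (t %/ q)%Z; rewrite jE PoszM.
  by have := divz_eq t q; lia.
case: (ltnP j (size s)) => js; last by right; exists j; rewrite // js.
have := mem_nth 0 js; set d := nth 0 s j => ds.
have := ds; rewrite mem_new_divisors // => /andP[dn dnq].
left; exists d.
  rewrite dnq andbT ltn_neqAle (dvdn_gt0 _ dnq) ?muln_gt0 ?n0 // andbT.
  by apply: contraNneq dn => <-.
rewrite /g (negPf dn) /d index_uniq ?filter_uniq ?divisors_uniq //.
exact: dvdz_trans zj.
Qed.

Lemma almost_covering_mul (n q : nat) : 0 < n -> 0 < q ->
  almost_covering n -> q <= (size (new_divisors n q)).+1 ->
  almost_covering (n * q).
Proof.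
move=> n0 q0 acn qs; have [f [c fP]] := almost_covering_extend _ _ n0 q0 acn.
exists f, (c + n%:Z * q.-1%:Z)%R => z.
case: (fP z) => [|[j /andP[sj jq] zj]]; [by right|left].
by rewrite (_ : q.-1 = j) //; lia.
Qed.

Lemma covering_number_mul (n q : nat) : 0 < n -> 0 < q ->
  almost_covering n -> q <= size (new_divisors n q) -> covering_number (n * q).
Proof.
move=> n0 q0 acn qs; have [f [c fP]] := almost_covering_extend _ _ n0 q0 acn.
apply/covering_numberP; rewrite ?muln_gt0 ?n0 //; exists f => z.
by case: (fP z) => // -[j /andP[sj jq]]; rewrite ltnNge (leq_trans qs) in jq.
Qed.

(** Pigeonhole: if [x] is missed by the divisors of [n], each of the [q] lifts x + n j needs a new
    divisor, and no new divisor serves two lifts. *)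
Lemma not_covering_number_mul (n q : nat) : 0 < n -> prime q ->
  ~ covering_number n -> size (new_divisors n q) < q ->
  ~ covering_number (n * q).
Proof.
move=> n0 q_pr nc sq; have q0 := prime_gt0 q_pr.
move=> /covering_numberP; rewrite muln_gt0 n0 q0 => /(_ isT) [f fP].
apply: nc; apply/covering_numberP => //; exists f; apply: contrapT.
move=> /existsNP[x nx].
have dP (j : 'I_q) : exists2 d, d \in new_divisors n q &
    (d %| (x + n%:Z * j%:Z - f d)%R)%Z.
  have [d /andP[d1 dnq] dz] := fP (x + n%:Z * j%:Z)%R; exists d => //.
  rewrite mem_new_divisors // dnq andbT; apply/negP => dn; apply: nx.
  exists d; rewrite ?d1 //.
  have -> : (x - f d = (x + n%:Z * j%:Z - f d) - n%:Z * j%:Z)%R by ring.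
  by rewrite rpredB //; apply: dvdz_mulr.
have [h hs hz] := fin_all_exists2 dP.
have h_inj : injective h.
  suff lt_neq (i j : 'I_q) : i < j -> h i <> h j.
    move=> i j hij; apply/val_inj.
    by case: (ltngtP i j) => // /lt_neq; rewrite hij.
  move=> ij hij; have := hs j.
  rewrite mem_new_divisors // => /andP[/negP + hnq].
  apply; have : h j %| n * (j - i).
    have := hz i; rewrite hij => /(rpredB (hz j)).
    rewrite (_ : (_ - _)%R = Posz (n * (j - i))) //.
    by rewrite PoszM -subzn 1?ltnW //; ring.
  move=> hnji; have : h j %| gcdn (n * q) (n * (j - i)) by rewrite dvdn_gcd hnq.
  (* Since 0 < j - i < q, the gcd is [n], so [h j] would divide [n] and not be new. *)
  rewrite -muln_gcdr; suff /eqP -> : coprime q (j - i) by rewrite muln1.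
  rewrite prime_coprime //; apply/negP => /dvdn_leq.
  by have := ltn_ord j; lia.
have : size (codom h) <= size (new_divisors n q).
  by apply: uniq_leq_size; [apply/injectiveP | move=> _ /codomP[j ->]].
by rewrite size_codom card_ord leqNgt sq.
Qed.

Lemma covering_number_dvd (m n : nat) :
  0 < n -> m %| n -> covering_number m -> covering_number n.
Proof.
move=> n0 mn [_ [S [covS uS gt1 dvdS]]]; split=> //; exists S; split=> // c cS.
exact: dvdn_trans (dvdS c cS) mn.
Qed.

(** * Divisors and prime divisors of [n * q ^ i] *)

Lemma prime_ndvd (n q : nat) :
  0 < n -> prime q -> {in primes n, forall p, p < q} -> ~~ (q %| n).
Proof.
move=> n0 q_pr ltq; apply/negP => qn.
suff /ltq : q \in primes n by rewrite ltnn.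
by rewrite mem_primes q_pr n0.
Qed.

Lemma prime_ndvd_pfactor (p n q i : nat) :
  prime p -> ~~ (p %| n * q) -> ~~ (p %| n * q ^ i).
Proof.
move=> p_pr; apply: contraNN; rewrite !Euclid_dvdM // Euclid_dvdX //.
by case/orP=> [->|/andP[-> _]]; rewrite ?orbT.
Qed.

Lemma dvdn_mul_pfactor (d n q i : nat) : prime q -> d %| n * q ^ i ->
  exists e j, [/\ e %| n, j <= i & d = e * q ^ j].
Proof.
move=> q_pr dnq; set g := gcdn d (q ^ i).
have g0 : 0 < g by rewrite gcdn_gt0 expn_gt0 (prime_gt0 q_pr) orbT.
have /(dvdn_pfactor _ _ q_pr)[j ji gE] := dvdn_gcdr d (q ^ i).
exists (d %/ g), j; split=> //; last by rewrite -gE divnK ?dvdn_gcdl.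
have co : coprime (d %/ g) (q ^ i %/ g).
  rewrite /coprime -(eqn_pmul2r g0) muln_gcdl mul1n !divnK //.
    exact: dvdn_gcdr.
  exact: dvdn_gcdl.
rewrite -(Gauss_dvdl _ co) -(dvdn_pmul2r g0) -mulnA !divnK //.
  exact: dvdn_gcdr.
exact: dvdn_gcdl.
Qed.

(** The new divisors are exactly the e q^(i+1) with e dividing [n]. *)
Lemma size_new_divisors_pfactor (n q i : nat) : 0 < n -> prime q ->
  ~~ (q %| n) -> size (new_divisors (n * q ^ i) q) = size (divisors n).
Proof.
move=> n0 q_pr qn; have q0 := prime_gt0 q_pr.
have qi0 j : 0 < q ^ j by rewrite expn_gt0 q0.
rewrite -[RHS](size_map (fun e => e * q ^ i.+1)); apply/perm_size/uniq_perm.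
- by rewrite filter_uniq ?divisors_uniq.
- rewrite map_inj_uniq ?divisors_uniq // => e e' /eqP.
  by rewrite eqn_pmul2r ?qi0 // => /eqP.
move=> d; rewrite mem_new_divisors ?muln_gt0 ?n0 ?qi0 //.
rewrite -mulnA -expnSr; apply/andP/mapP => [[ndvd dvd]|[e + ->]].
  have [e [j [en ji dE]]] := dvdn_mul_pfactor _ _ _ _ q_pr dvd.
  exists e; rewrite -?dvdn_divisors // dE; congr (_ * q ^ _).
  apply/eqP; rewrite eqn_leq ji ltnNge; apply: contraNN ndvd => ji'.
  by rewrite dE dvdn_mul // dvdn_exp2l.
rewrite -dvdn_divisors // => en; split; last exact: dvdn_mul.
rewrite expnS mulnA dvdn_pmul2r ?qi0 //; apply: contraNN qn.
exact: dvdn_trans (dvdn_mull _ (dvdnn q)).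
Qed.

Lemma size_divisors_pfactor (n q i : nat) : 0 < n -> prime q -> ~~ (q %| n) ->
  size (divisors (n * q ^ i)) = size (divisors n) * i.+1.
Proof.
move=> n0 q_pr qn; elim: i => [|i IH]; first by rewrite !muln1.
have nqi0 : 0 < n * q ^ i by rewrite muln_gt0 n0 expn_gt0 prime_gt0.
rewrite expnSr mulnA (size_new_divisors _ _ nqi0 (prime_gt0 q_pr)).
by rewrite size_new_divisors_pfactor // IH [RHS]mulnSr.
Qed.

Lemma size_divisors_dvd (m n : nat) : 0 < n -> m %| n ->
  size (divisors m) <= size (divisors n) ?= iff (m == n).
Proof.
move=> n0 mn; have m0 := dvdn_gt0 n0 mn.
have sub : {subset divisors m <= divisors n}.
  by move=> d; rewrite -!dvdn_divisors // => /dvdn_trans; apply.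
split; first exact: uniq_leq_size (divisors_uniq m) sub.
apply/eqP/eqP => [sz|-> //]; apply/eqP; rewrite eqn_dvd mn /=.
rewrite dvdn_divisors //.
have [_ ->] := uniq_min_size (divisors_uniq m) sub (eq_leq (esym sz)).
exact: divisors_id.
Qed.

Lemma size_primes_pfactor (n q i : nat) : 0 < n -> prime q -> ~~ (q %| n) ->
  0 < i -> size (primes (n * q ^ i)) = (size (primes n)).+1.
Proof.
move=> n0 q_pr qn i0; apply: (perm_size (s2 := q :: primes n)).
apply: uniq_perm; rewrite /= ?primes_uniq ?andbT //.
  by rewrite mem_primes q_pr n0.
move=> p; rewrite primesM ?expn_gt0 ?(prime_gt0 q_pr) // primesX //.
by rewrite (primes_prime q_pr) !inE orbC.
Qed.

(** * Prime powers and the inductive chain *)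

Lemma almost_covering_pfactor (n q i : nat) : 0 < n -> prime q ->
  ~~ (q %| n) -> q <= (size (divisors n)).+1 -> almost_covering n ->
  almost_covering (n * q ^ i).
Proof.
move=> n0 q_pr qn sq acn; elim: i => [|i IH]; first by rewrite muln1.
have q0 := prime_gt0 q_pr.
rewrite expnSr mulnA; apply: almost_covering_mul => //.
  by rewrite muln_gt0 n0 expn_gt0 q0.
by rewrite size_new_divisors_pfactor.
Qed.

Lemma not_covering_number_pfactor (n q i : nat) : 0 < n -> prime q ->
  ~~ (q %| n) -> size (divisors n) < q -> ~ covering_number n ->
  ~ covering_number (n * q ^ i).
Proof.
move=> n0 q_pr qn sq ncn; elim: i => [|i IH]; first by rewrite muln1.
rewrite expnSr mulnA; apply: not_covering_number_mul => //.
  by rewrite muln_gt0 n0 expn_gt0 prime_gt0.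
by rewrite size_new_divisors_pfactor.
Qed.

Lemma covering_chain (r : nat) : exists A q,
  [/\ 0 < A, prime q, {in primes A, forall p, p < q} &
      size (divisors A) = q.-1] /\
  [/\ almost_covering A, ~ covering_number A & size (primes A) = r].
Proof.
elim: r => [|r [A [q [[A0 q_pr ltq dA] [acA ncA rA]]]]].
  exists 1, 2; split; split=> //.
    by exists (fun=> 0%R), 0%R => z; left; rewrite dvd1z.
  move=> /covering_numberP[] // f /(_ 0%R) [d /andP[d1]].
  by rewrite dvdn1 => /eqP d_eq1; rewrite d_eq1 in d1.
have qA := prime_ndvd _ _ A0 q_pr ltq.
have [q0 q1] := (prime_gt0 q_pr, prime_gt1 q_pr).
have [|q' q'_pr] := prime_1_mod (2 * q.-1); first by lia.
move=> /dvdnP[k q'E]; have q'1 := prime_gt1 q'_pr.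
have k0 : 0 < k by case: k q'E => [|//]; lia.
pose a := (2 * k).-1.
have sq : size (divisors A) < q by rewrite dA; lia.
exists (A * q ^ a), q'; split; split=> //.
- by rewrite muln_gt0 A0 expn_gt0 q0.
- have qq' : q < q' by nia.
  move=> p; rewrite primesM ?expn_gt0 ?q0 // primesX; last by lia.
  rewrite (primes_prime q_pr) inE => /orP[/ltq|/eqP -> //].
  by move=> /ltn_trans; apply.
- by rewrite size_divisors_pfactor // dA q'E; rewrite /a; nia.
- by apply: almost_covering_pfactor; rewrite // dA; lia.
- exact: not_covering_number_pfactor.
- by rewrite size_primes_pfactor ?rA //; lia.
Qed.

Lemma primitive_covering_number_chain (A q p : nat) :
  0 < A -> prime q -> ~~ (q %| A) -> size (divisors A) = q.-1 ->
  almost_covering A -> ~ covering_number A ->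
  prime p -> ~~ (p %| A * q) -> q * q <= p ->
  primitive_covering_number (A * q ^ (p.-1 %/ q.-1) * p).
Proof.
move=> A0 q_pr qA dA acA ncA p_pr pAq qqp; set b := _ %/ _.
have [q0 q1] := (prime_gt0 q_pr, prime_gt1 q_pr).
have [p0 p1] := (prime_gt0 p_pr, prime_gt1 p_pr).
have qb_le : q.-1 * b <= p.-1 by rewrite mulnC leq_divM.
have qb_lt : p.-1 < q.-1 * b.+1 by rewrite mulnC ltn_ceil //; lia.
have b_ge : q.-2 <= b by rewrite leq_divRL; nia.
have b0 : 0 < b by rewrite divn_gt0; nia.
set B := A * q ^ b; have B0 : 0 < B by rewrite muln_gt0 A0 expn_gt0 q0.
have pB : ~~ (p %| B) by apply: prime_ndvd_pfactor.
have ncB : ~ covering_number B.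
  by apply: not_covering_number_pfactor => //; rewrite dA; lia.
split.
  apply: covering_number_mul => //.
    by apply: almost_covering_pfactor; rewrite // dA; lia.
  rewrite -[B]muln1 -(expn0 p) size_new_divisors_pfactor //.
  by rewrite size_divisors_pfactor // dA -(prednK p0).
move=> d d0 dlt ddvd; have [|pd] := boolP (p %| d); last first.
  move=> covd; apply: ncB; apply: covering_number_dvd covd => //.
  by move: ddvd; rewrite Gauss_dvdl // coprime_sym prime_coprime.
move=> /dvdnP[m dE]; move: ddvd dlt; rewrite dE.
rewrite dvdn_pmul2r ?ltn_pmul2r // => mB m_lt.
have m0 := dvdn_gt0 B0 mB.
have pm : ~~ (p %| m) by apply: contraNN pB => /dvdn_trans; apply.
have ncm : ~ covering_number m by move/(covering_number_dvd _ _ B0 mB).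
rewrite -(expn1 p); apply: not_covering_number_pfactor => //.
have [e [j [eA jb mE]]] := dvdn_mul_pfactor _ _ _ _ q_pr mB.
rewrite -(prednK p0) ltnS; apply: leq_trans qb_le.
move: jb; rewrite leq_eqVlt => /orP[/eqP jb|jb].
  have e_lt : size (divisors e) < size (divisors A).
    rewrite (ltn_leqif (size_divisors_dvd e A A0 eA)).
    by apply: contraTneq m_lt => eE; rewrite mE eE jb ltnn.
  rewrite mE jb size_divisors_pfactor ?(dvdn_gt0 A0 eA) //.
    move: e_lt b_ge; rewrite dA; move: (size _); clear; clearbody b; nia.
  by apply: contraNN qA => /dvdn_trans; apply.
rewrite -dA -(prednK b0) -(size_divisors_pfactor _ _ _ A0 q_pr qA).
apply/size_divisors_dvd; first by rewrite muln_gt0 A0 expn_gt0 q0.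
by rewrite mE dvdn_mul // dvdn_exp2l // -ltnS prednK.
Qed.

Theorem corollary1p2 (r : nat) (hr : (2 <= r)%N) :
  infinite_set
    [set n : nat | primitive_covering_number n /\ size (primes n) = r]%classic.
Proof.
have [A [q [[A0 q_pr ltq dA] [acA ncA rA]]]] := covering_chain r.-2.
have qA := prime_ndvd _ _ A0 q_pr ltq.
have [q0 q1] := (prime_gt0 q_pr, prime_gt1 q_pr).
move=> /finite_seqP[s sE].
have [p p_gt p_pr] := prime_above (A * q * q + \max_(n <- s) n).
have pAq : ~~ (p %| A * q).
  by apply/negP => /dvdn_leq; rewrite muln_gt0 A0 q0 => /(_ isT); nia.
have qqp : q * q <= p by nia.
have qp : q <= p := leq_trans (leq_pmulr q q0) qqp.
have b0 : 0 < p.-1 %/ q.-1 by rewrite divn_gt0 -!subn1 ?leq_sub2r ?subn_gt0.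
have B0 : 0 < A * q ^ (p.-1 %/ q.-1) by rewrite muln_gt0 A0 expn_gt0 q0.
set n := A * q ^ (p.-1 %/ q.-1) * p.
have /= ns : [set` s]%classic n.
  rewrite -sE; split; first exact: primitive_covering_number_chain.
  rewrite /n -[X in _ * X]expn1 size_primes_pfactor //.
    by rewrite size_primes_pfactor // rA; case: r hr {sE rA} => [|[]].
  exact: prime_ndvd_pfactor.
have : n <= \max_(m <- s) m by apply: leq_bigmax_seq.
have pn : p <= n by apply: leq_pmull.
by move: p_gt; clear - pn; move: n pn; lia.
Qed.
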